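(* (a) The validity of the assertion ''for all integers $M\ge2$, $P(X\text{ is }M\text{-seen in }Y)=0$'', where $X$ and $Y$ are independent Bernoulli sequences with parameters $p_X$ and $p_Y$ respectively, does not depend on the values of $p_X,p_Y\in(0,1)$. That is, if the assertion holds for one pair $(p_X,p_Y)\in(0,1)^2$, then it holds for every pair in $(0,1)^2$. (b) Let $W\in\{0,1\}^{\mathbb N}$ be an arbitrary infinite word. The validity of the assertion ''for all integers $M\ge2$, $P(W\text{ is }M\text{-seen in }Y)=0$'', where $Y$ is a Bernoulli sequence with parameter $p_Y$, does not depend on the value of $p_Y\in(0,1)$. That is, if the assertion holds for one $p_Y\in(0,1)$, then it holds for every $p_Y\in(0,1)$.
   Context: A Bernoulli sequence with parameter $p\in(0,1)$ is an i.i.d. sequence $(Y_1,Y_2,\dots)$ of $\{0,1\}$-valued random variables with $P(Y_j=1)=p$. For a positive integer $M$, an infinite word $W=(w_1,w_2,\dots)\in\{0,1\}^{\mathbb N}$ (deterministic or random) is $M$-seen in $Y$ if there is a sequence of integers $(m_i:i\ge1)$ such that, with $m_0=0$, $1\le m_i-m_{i-1}\le M$ and $Y_{m_i}=w_i$ for every $i\ge1$. *)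

(* Defs.v *)
From mathcomp Require Export all_boot all_order all_algebra finmap.
From mathcomp Require Export all_classical all_reals all_analysis.

Set Implicit Arguments.
Unset Strict Implicit.
Unset Printing Implicit Defensive.

Import Order.TTheory GRing.Theory Num.Theory.

Local Open Scope classical_set_scope.
Local Open Scope ring_scope.

(* An infinite word (w_1, w_2, ...) is a function [w : nat -> bool] whose value
   at [i] is the letter w_{i+1}: letters are indexed from 0 and [true] stands
   for 1. The integers m_i keep their original indexing, m 0 being m_0 = 0. They
   are positive for i >= 1, so the letter of [y] at position m_{i+1} is
   [y (m i.+1).-1]. *)
Definition seen_in (M : nat) (w y : nat -> bool) : Prop :=
  exists m : nat -> nat, m 0%N = 0%N /\
    forall i, [/\ (m i < m i.+1)%N, (m i.+1 <= m i + M)%N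
                & y (m i.+1).-1 = w i].

Section independence.
Context d (T : measurableType d) (R : realType) (P : probability T R).

Definition mutually_independent d' (T' : measurableType d') (I : choiceType)
    (X : I -> {RV P >-> T'}) : Prop :=
  forall (J : {fset I}) (A : I -> set T'), (forall i, measurable (A i)) ->
    P (\bigcap_(i in [set` J]) (X i @^-1` A i)) =
    (\prod_(i <- J) P (X i @^-1` A i))%E.

Definition sigma_of_seq d' (T' : measurableType d') (X : nat -> {RV P >-> T'})
    : set (set T) :=
  <<s \bigcup_i g_sigma_algebra_preimage (X i) >>.

Definition independent_seqs d' (T' : measurableType d')
    (X Y : nat -> {RV P >-> T'}) : Prop :=
  forall A B : set T, sigma_of_seq X A -> sigma_of_seq Y B ->
    P (A `&` B) = (P A * P B)%E.

Definition bernoulli_sequence (p : R) (Y : nat -> {RV P >-> bool}) : Prop :=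
  mutually_independent Y /\ forall j, P (Y j @^-1` [set true]) = p%:E.

End independence.

(* Main.v *)
(* Whether a prefix of the word is seen depends on finitely many letters, and by
   compactness an infinite word is seen as soon as all its prefixes are, so it
   suffices to compare finite Bernoulli expectations.

   Cut a Bernoulli(p) sequence into blocks of length L. For L large almost every
   block contains both letters, hence for any p' the sequence can be coupled to
   a Bernoulli(p') sequence Z with Z_k occurring in the k-th block. If Y is cut
   and the word is M-seen in Z, it is L(M+1)-seen in Y. If X is cut and X is
   M-seen in Y, then Z, a subword of X with gaps less than 2L, is 2LM-seen in Y.
   Parameters can thus be changed at the cost of enlarging M. *)

Require Import Defs.
From mathcomp Require Import zify ring lra.

Set Implicit Arguments.
Unset Strict Implicit.
Unset Printing Implicit Defensive.

Import Order.TTheory GRing.Theory Num.Theory.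

Local Open Scope classical_set_scope.
Local Open Scope ring_scope.

(** * Embeddings of finite prefixes, compactness, and cutting into blocks *)

Definition seen_upto (M n : nat) (w y : nat -> bool) : Prop :=
  exists m : nat -> nat, m 0%N = 0%N /\
    forall i, (i < n)%N -> [/\ (m i < m i.+1)%N, (m i.+1 <= m i + M)%N
                & y (m i.+1).-1 = w i].

Lemma position_le (M n : nat) (m : nat -> nat) :
  (forall i, (i < n)%N -> (m i.+1 <= m i + M)%N) ->
  forall i j, (i <= j <= n)%N -> (m j <= m i + M * (j - i))%N.
Proof.
move=> mM i; elim=> [|j IH] /andP[ij jn]; first by (have -> : i = 0%N by lia); lia.
have [<-|ij'] := eqVneq i j.+1; first by lia.
have /IH : (i <= j <= n)%N by lia.
have := mM j jn; nia.
Qed.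

Lemma position_lt (n : nat) (m : nat -> nat) :
  (forall i, (i < n)%N -> (m i < m i.+1)%N) ->
  forall i j, (i < j <= n)%N -> (m i < m j)%N.
Proof.
move=> mlt i; elim=> [|j IH] /andP[ij jn]; first by lia.
have := mlt j jn.
have [<-|ij'] := eqVneq i j; first by lia.
have /IH : (i < j <= n)%N by lia.
lia.
Qed.

Lemma seen_uptoW (M n n' : nat) (w y : nat -> bool) : (n <= n')%N ->
  seen_upto M n' w y -> seen_upto M n w y.
Proof.
by move=> nn [m [m0 mP]]; exists m; split=> // i ltin; apply: mP; apply: leq_trans nn.
Qed.

Lemma seen_in_upto (M n : nat) (w y : nat -> bool) :
  seen_in M w y -> seen_upto M n w y.
Proof. by move=> [m [m0 mP]]; exists m; split=> // i _; apply: mP. Qed.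

(** Gaps of at most [M] keep the first [n] positions within [M * n], so no later letter of [y] is
    read. *)
Lemma eq_seen_upto (M n : nat) (w w' y y' : nat -> bool) :
  (forall i, (i < n)%N -> w i = w' i) ->
  (forall j, (j < M * n)%N -> y j = y' j) ->
  seen_upto M n w y -> seen_upto M n w' y'.
Proof.
move=> ww yy [m [m0 mP]]; exists m; split=> // i ltin.
have [mlt mle ymw] := mP i ltin; split=> //.
rewrite -ww // -ymw yy //.
have := @position_le M n m (fun k kn => let: And3 _ h _ := mP k kn in h) 0 i.+1.
by rewrite m0 add0n ltin; nia.
Qed.

Lemma seen_uptoS (M n : nat) (w y : nat -> bool) : seen_upto M n.+1 w y ->
  exists k, [/\ (0 < k <= M)%N, y k.-1 = w 0%N
    & seen_upto M n (fun i => w i.+1) (fun j => y (k + j)%N)].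
Proof.
move=> [m [m0 mP]]; have [lt0 le0 y0] := mP 0%N isT.
exists (m 1%N); split=> //; first by lia.
(* The subtraction is truncated; [lem1] makes it exact. *)
exists (fun i => m i.+1 - m 1)%N; split=> [|i ltin]; first by lia.
have [mlt mle ymw] := mP i.+1 ltin.
have lem1 : (m 1 <= m i.+1)%N.
  case: i ltin {mlt mle ymw} => // i ltin.
  by apply/ltnW/(@position_lt n.+1 m (fun k kn => let: And3 h _ _ := mP k kn in h)); lia.
by split; [lia|lia|rewrite -ymw; congr y; lia].
Qed.

(* Konig's lemma: among the at most [M] possible first positions, one can be
   extended to embeddings of every finite prefix. *)
Lemma seen_upto_step (M : nat) (w y : nat -> bool) :
  (forall n, seen_upto M n w y) ->
  exists k, [/\ (0 < k <= M)%N, y k.-1 = w 0%N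
    & forall n, seen_upto M n (fun i => w i.+1) (fun j => y (k + j)%N)].
Proof.
move=> seen; apply: contrapT => nostep.
pose bad k n := (0 < k <= M)%N -> y k.-1 = w 0%N ->
  ~ seen_upto M n (fun i => w i.+1) (fun j => y (k + j)%N).
have /choice [f fP] : forall k, exists n, bad k n.
  move=> k; apply: contrapT => /forallNP kbad; apply: nostep; exists k.
  split; first by apply: contrapT => h; apply: (kbad 0%N) => /h.
    by apply: contrapT => h; apply: (kbad 0%N) => _ /h.
  by move=> n; apply: contrapT => h; apply: (kbad n).
(* The prefix is so long that its tail reaches every bound [f k] with [k <= M], whichever first
   position it yields. *)
have [k [kM yk sk]] := seen_uptoS (seen (\max_(k < M.+1) f k).+1).
apply: (fP k) => //; apply: seen_uptoW sk.
by have /andP[_ kM'] := kM; exact: (leq_bigmax (Ordinal (kM' : (k < M.+1)%N))).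
Qed.

(** For the converse, positions are chosen one by one, keeping every prefix of the remaining word
    embeddable after the current position. *)
Lemma seen_inP (M : nat) (w y : nat -> bool) :
  seen_in M w y <-> forall n, seen_upto M n w y.
Proof.
split=> [h n|seen]; first exact: seen_in_upto.
pose good i q := forall n,
  seen_upto M n (fun k => w (i + k)%N) (fun j => y (q + j)%N).
have /choice [f fP] : forall iq : nat * nat, exists k, good iq.1 iq.2 ->
    [/\ (0 < k <= M)%N, y (iq.2 + k).-1 = w iq.1 & good iq.1.+1 (iq.2 + k)%N].
  move=> [i q] /=; have [/seen_upto_step|nh] := pselect (good i q); last by exists 0%N.
  move=> [k [kM yk gk]]; exists k => _; split=> //.
    by rewrite addn0 in yk; rewrite -yk; congr y; lia.
  move=> n; apply: eq_seen_upto (gk n) => j _.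
    by congr w; lia.
  by congr y; lia.
pose m := fix m i := if i is i'.+1 then (m i' + f (i', m i'))%N else 0%N.
have gm i : good i (m i).
  elim: i => [|i IH]; first exact: seen.
  by have [] := fP (i, m i) IH.
exists m; split=> // i.
by have [/= fM yw _] := fP (i, m i) (gm i); split=> //=; lia.
Qed.

(** Index [k] of [z] is sent to the place of [z k] in block [k] of [y]. Later indices lie in later
    blocks, so order is kept, and indices at most [M] apart give gaps below [L * M.+1]. *)
Lemma seen_upto_blocks (M n L : nat) (w z y : nat -> bool) :
  (forall k, (k < M * n)%N -> exists2 c, (c < L)%N & y (L * k + c)%N = z k) ->
  seen_upto M n w z -> seen_upto (L * M.+1) n w y.
Proof.
move=> zy [m [m0 mP]].
have /choice [c cP] : forall k, exists c, (k < M * n)%N ->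
    (c < L)%N /\ y (L * k + c)%N = z k.
  move=> k; have [/zy[c]|_] := ltnP k (M * n); last by exists 0%N.
  by exists c.
have mMn i : (i < n)%N -> ((m i.+1).-1 < M * n)%N.
  move=> ltin; have := @position_le M n m (fun k kn => let: And3 _ h _ := mP k kn in h) 0 i.+1.
  by have [] := mP i ltin; rewrite m0 add0n ltin; nia.
(* Positions count from 1 and letter indices from 0, whence [.-1] and [.+1]; the value 0 is the
   initial position. *)
exists (fun i => if i is j.+1 then (L * (m j.+1).-1 + c (m j.+1).-1).+1 else 0%N).
split=> // -[|i] ltin.
  have [mlt mle <-] := mP 0%N ltin; have [cL <-] := cP _ (mMn 0%N ltin).
  by split=> //; rewrite m0 in mle; nia.
have [mlt mle <-] := mP i.+1 ltin; have [cL <-] := cP _ (mMn _ ltin).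
have [cL' _] := cP _ (mMn i (ltnW ltin)).
have [mlt' _ _] := mP i (ltnW ltin).
have lo : (L * (m i.+1).-1.+1 <= L * (m i.+2).-1)%N by rewrite leq_mul //; lia.
have hi : (L * (m i.+2).-1 <= L * ((m i.+1).-1 + M))%N by rewrite leq_mul //; lia.
by split=> //; lia.
Qed.

(** Keep only the positions at which the selected letters of [w] are read. Selected letters of
    adjacent blocks are less than [L.*2] apart, and each letter of [w] advances in [y] by at most
    [M]. *)
Lemma seen_upto_subword (M n L : nat) (w z y : nat -> bool) :
  (forall k, (k < n)%N -> exists2 c, (c < L)%N & w (L * k + c)%N = z k) ->
  seen_upto M (L * n) w y -> seen_upto (M * L.*2) n z y.
Proof.
move=> zw [m [m0 mP]].
have mle := @position_le M _ m (fun k kn => let: And3 _ h _ := mP k kn in h).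
have mlt := @position_lt _ m (fun k kn => let: And3 h _ _ := mP k kn in h).
have /choice [c cP] : forall k, exists c, (k < n)%N ->
    (c < L)%N /\ w (L * k + c)%N = z k.
  move=> k; have [/zw[c]|_] := ltnP k n; last by exists 0%N.
  by exists c.
exists (fun i => if i is j.+1 then m (L * j + c j).+1 else 0%N).
split=> // -[|i] ltin.
  have [cL <-] := cP _ ltin.
  have ltm : (L * 0 + c 0 < L * n)%N by nia.
  have [_ _ ->] := mP _ ltm; split=> //.
    have /mlt : (0 < (L * 0 + c 0).+1 <= L * n)%N by rewrite ltm.
    by rewrite m0.
  have /mle : (0 <= (L * 0 + c 0).+1 <= L * n)%N by rewrite ltm.
  by move/leq_trans; apply; rewrite m0 !add0n leq_mul //; lia.
have [cL <-] := cP _ ltin; have [cL' _] := cP _ (ltnW ltin).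
have ltm : (L * i.+1 + c i.+1 < L * n)%N by nia.
have [_ _ ->] := mP _ ltm; split=> //.
  by apply: mlt; rewrite ltm andbT; nia.
have /mle : ((L * i + c i).+1 <= (L * i.+1 + c i.+1).+1 <= L * n)%N.
  by rewrite ltm andbT; nia.
by move/leq_trans; apply; rewrite leq_add2l leq_mul //; lia.
Qed.

(** * Finite Bernoulli expectations and the block coupling *)

Section bernoulli_expectation.
Context (R : realType).
Implicit Types (p : R) (F G H : seq bool -> R).

Definition bern p (b : bool) : R := if b then p else 1 - p.

(* Expectation of [F] at a word of [n] independent Bernoulli([p]) letters. *)
Fixpoint bexp p (n : nat) F : R :=
  if n is n'.+1 then
    p * bexp p n' (fun z => F (true :: z)) +
    (1 - p) * bexp p n' (fun z => F (false :: z))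
  else F [::].

Lemma le_bexp p n F G : 0 < p < 1 ->
  (forall z, size z = n -> F z <= G z) -> bexp p n F <= bexp p n G.
Proof.
move=> /andP[p0 p1]; elim: n F G => [|n IH] F G FG /=; first exact: FG.
have q0 : 0 <= 1 - p by rewrite subr_ge0 ltW.
apply: lerD; apply: ler_wpM2l => //; first exact: ltW.
  by apply: IH => z zn; apply: FG; rewrite /= zn.
by apply: IH => z zn; apply: FG; rewrite /= zn.
Qed.

Lemma bexp_cst p n (a : R) : bexp p n (fun=> a) = a.
Proof. by elim: n => //= n ->; ring. Qed.

Lemma bexpN p n F : bexp p n (fun z => - F z) = - bexp p n F.
Proof. by elim: n F => //= n IH F; rewrite !IH; ring. Qed.

Lemma bexpD p m n F :
  bexp p (m + n) F = bexp p m (fun u => bexp p n (fun v => F (u ++ v))).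
Proof. by elim: m F => //= m IH F; rewrite !IH. Qed.

(** A word of [L] letters lacks [c] with probability [bern p (~~ c) ^+ L], and only then may [H]
    drop below [a'], at worst to [a]. In the induction a first letter [c] secures [a']; the other
    letter leaves one letter less to search. *)
Lemma bexp_has_letter p L H (c : bool) (a a' : R) : 0 < p < 1 -> a <= a' ->
  (forall u, size u = L -> a <= H u) ->
  (forall u, size u = L -> c \in u -> a' <= H u) ->
  a' - bern p (~~ c) ^+ L * (a' - a) <= bexp p L H.
Proof.
move=> p01 aa'; have /andP[p0 p1] := p01.
elim: L H => [|L IH] H Ha Ha' /=.
  by rewrite expr0 mul1r opprB addrC subrK; exact: Ha.
have Hc : a' <= bexp p L (fun z => H (c :: z)).
  rewrite -[leLHS](bexp_cst p L); apply: le_bexp => // z zL.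
  by apply: Ha'; rewrite ?mem_head //= zL.
have Hnc : a' - bern p (~~ c) ^+ L * (a' - a) <= bexp p L (fun z => H (~~ c :: z)).
  apply: IH => z zL; first by apply: Ha; rewrite /= zL.
  by move=> cz; apply: Ha'; rewrite /= ?zL // inE cz orbT.
case: c {IH Ha'} Hc Hnc => /= Hc Hnc; rewrite exprS.
- have := ler_wpM2l (ltW p0) Hc.
  have : 0 <= 1 - p by lra.
  move=> /ler_wpM2l /(_ _ _ Hnc).
  set e := (1 - p) ^+ L; nra.
- have := ler_wpM2l (ltW p0) Hnc.
  have : 0 <= 1 - p by lra.
  move=> /ler_wpM2l /(_ _ _ Hc).
  set e := p ^+ L; nra.
Qed.

(* Cut the second sequence into blocks of length [L]. A block that contains both
   letters can play the role of either of them, and the other blocks are so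
   rare that the missing probability can be distributed to get parameter [p']. *)
Lemma le_bexp_blocks p p' (L N : nat) F G : 0 < p < 1 -> 0 < p' < 1 ->
  p ^+ L <= p' -> (1 - p) ^+ L <= 1 - p' ->
  (forall z y, size z = N -> size y = (L * N)%N ->
    (forall k, (k < N)%N ->
       exists2 c, (c < L)%N & nth false y (L * k + c) = nth false z k) ->
    F z <= G y) ->
  bexp p' N F <= bexp p (L * N) G.
Proof.
move=> p01 p'01 pL qL.
(* For [L = 0] the hypothesis [pL] would read [1 <= p']. *)
have L0 : (0 < L)%N.
  by case: (L) pL => //; rewrite expr0 => ?; lra.
elim: N F G => [|N IH] F G FG.
  by rewrite muln0 /=; apply: FG => //; rewrite muln0.
rewrite mulnS bexpD /=.
(* [a1] and [a0] are the expectations of [F] when [z] starts with [true] and with [false]. *)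
set a1 := bexp p' N _; set a0 := bexp p' N _.
have Hb b u : size u = L -> b \in u ->
    bexp p' N (fun z => F (b :: z)) <= bexp p (L * N) (fun v => G (u ++ v)).
  move=> uL bu; apply: IH => z y zN yN zy; apply: FG.
  - by rewrite /= zN.
  - by rewrite size_cat uL yN mulnS.
  case=> [_|k kN] /=.
    exists (index b u); first by rewrite -uL index_mem.
    by rewrite muln0 nth_cat index_mem bu nth_index.
  have [c cL yc] := zy k kN; exists c => //.
  by rewrite nth_cat uL mulnS -addnA ltnNge leq_addr /= addKn.
(* The more favourable letter is played whenever the first block contains it. By [qL] or [pL] this
   fails with at most the probability of the other letter under [p'], and then any letter of the
   block gives at least the smaller value. *)
have [a01|a10] := leP a0 a1.
- have H0 u : size u = L -> a0 <= bexp p (L * N) (fun v => G (u ++ v)).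
    case: u => [|b u] uL; first by rewrite -uL in L0.
    have := Hb b (b :: u) uL (mem_head _ _).
    by case: b {uL} => // h; apply: le_trans h.
  have := bexp_has_letter p01 a01 H0 (fun u uL => Hb true u uL).
  apply: le_trans; rewrite /=; move: qL; set e := (1 - p) ^+ L; nra.
- have H0 u : size u = L -> a1 <= bexp p (L * N) (fun v => G (u ++ v)).
    case: u => [|b u] uL; first by rewrite -uL in L0.
    have := Hb b (b :: u) uL (mem_head _ _).
    by case: b {uL} => // h; apply: le_trans h; exact: ltW.
  have := bexp_has_letter p01 (ltW a10) H0 (fun u uL => Hb false u uL).
  apply: le_trans; rewrite /=; move: pL; set e := p ^+ L; nra.
Qed.

(** Both powers tend to 0 as [L] grows; these are the bounds that [le_bexp_blocks] needs. *)
Lemma block_length p p' : 0 < p < 1 -> 0 < p' < 1 ->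
  exists L, p ^+ L <= p' /\ (1 - p) ^+ L <= 1 - p'.
Proof.
move=> /andP[p0 p1] /andP[p'0 p'1].
have small (x e : R) : 0 < x < 1 -> 0 < e -> \forall L \near \oo, x ^+ L <= e.
  move=> /andP[x0 x1] e0.
  have /cvg_expr /cvgr0Pnorm_le /(_ e e0) : `|x| < 1 by rewrite gtr0_norm.
  by apply: filterS => L; apply: le_trans; exact: ler_norm.
have p01 : 0 < p < 1 by rewrite p0.
have q01 : 0 < 1 - p < 1 by rewrite subr_gt0 p1 ltrBlDr ltrDl.
have q'0 : 0 < 1 - p' by rewrite subr_gt0.
have [L _ /(_ L (leqnn L)) LP] := filterI (small p p' p01 p'0) (small _ _ q01 q'0).
by exists L.
Qed.

End bernoulli_expectation.

(** * Events determined by finite prefixes *)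

Section prefixes.
Context d (T : measurableType d) (R : realType) (P : probability T R).

Lemma set_prop_case (U : Type) (Q : Prop) :
  [set _ : U | Q] = setT \/ [set _ : U | Q] = set0.
Proof.
have [q|q] := pselect Q; [left|right]; apply/seteqP; split=> x //=.
Qed.

Lemma measurable_prop (Q : Prop) : measurable [set _ : T | Q].
Proof. by have [->|->] := set_prop_case T Q. Qed.

(** Splitting on the last letter uses only finite unions and intersections, so one induction serves
    both [measurable] and [sigma_of_seq]. As [C] takes events as values, the condition on the prefix
    may involve further randomness. *)
Lemma prefix_closed (K : set (set T)) (Y : nat -> T -> bool) :
  setU_closed K -> setI_closed K -> (forall i b, K (Y i @^-1` [set b])) ->
  forall n (C : seq bool -> set T), (forall u, K (C u)) ->
  K [set t | C (mkseq (Y^~ t) n) t].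
Proof.
move=> KU KI KY; elim=> [|n IH] C KC; first exact: KC.
have -> : [set t | C (mkseq (Y^~ t) n.+1) t] =
    (Y n @^-1` [set true] `&` [set t | C (rcons (mkseq (Y^~ t) n) true) t]) `|`
    (Y n @^-1` [set false] `&` [set t | C (rcons (mkseq (Y^~ t) n) false) t]).
  apply/seteqP; split=> t /=; rewrite mkseqS.
    by case: (Y n t); [left|right].
  by case=> -[->].
by apply: KU; apply: KI => //; [apply: (IH (fun u => C (rcons u true)))
  |apply: (IH (fun u => C (rcons u false)))].
Qed.

Lemma measurable_prefix (Y : nat -> {RV P >-> bool}) n (C : seq bool -> set T) :
  (forall u, measurable (C u)) ->
  measurable [set t | C (mkseq (fun i => Y i t) n) t].
Proof.
apply: (@prefix_closed measurable Y).
- by move=> A B; exact: measurableU.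
- by move=> A B; exact: measurableI.
- by move=> i b; exact: measurable_funPTI.
Qed.

Lemma sigma_of_seq_prefix (Y : nat -> {RV P >-> bool}) n (B : seq bool -> Prop) :
  sigma_of_seq Y [set t | B (mkseq (fun i => Y i t) n)].
Proof.
apply: (@prefix_closed (sigma_of_seq Y) Y _ _ _ n (fun u => [set _ | B u])).
- exact: (@measurableU _ (g_sigma_algebraType _)).
- exact: (@measurableI _ (g_sigma_algebraType _)).
- move=> i b; apply: sub_sigma_algebra; exists i => //.
  by exists [set b] => //; rewrite setTI.
- move=> u.
  have [->|->] := set_prop_case T (B u).
    exact: (@measurableT _ (g_sigma_algebraType _)).
  exact: (@measurable0 _ (g_sigma_algebraType _)).
Qed.

Let weight (p : R) (u : seq bool) : R := \prod_(b <- u) bern p b.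

Lemma probability_cylinder (p : R) (Y : nat -> {RV P >-> bool}) n u :
  bernoulli_sequence p Y -> size u = n ->
  P [set t | mkseq (fun i => Y i t) n = u] = (\prod_(b <- u) bern p b)%:E.
Proof.
move=> [indY pY] un.
have pYb i b : P (Y i @^-1` [set b]) = (bern p b)%:E.
  case: b; first exact: pY.
  rewrite (_ : _ @^-1` _ = ~` (Y i @^-1` [set true])); last first.
    by apply/seteqP; split=> t /=; case: (Y i t).
  by rewrite probability_setC ?pY //; exact: measurable_funPTI.
(* The cylinder is the intersection of the one-letter events at the indices below [n]. *)
have := indY [fset i in iota 0 n]%fset (fun i => [set nth false u i]) (fun=> I).
rewrite (_ : \bigcap_(i in _) _ = [set t | mkseq (fun i => Y i t) n = u]); last first.
  apply/seteqP; split=> t /=.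
    move=> h; apply: (@eq_from_nth _ false); rewrite size_mkseq // => i ltin.
    by rewrite nth_mkseq //; apply: h; rewrite /= !inE mem_iota.
  by move=> <- i; rewrite /= !inE mem_iota /= => ltin; rewrite nth_mkseq.
move=> ->.
rewrite (perm_big (iota 0 n)) /=; last first.
  by apply: uniq_perm; rewrite ?fset_uniq ?iota_uniq // => i; rewrite !inE.
rewrite (eq_bigr (fun i => (bern p (nth false u i))%:E)); last by move=> i _; exact: pYb.
by rewrite prodEFin [in RHS](big_nth false) un /index_iota subn0.
Qed.

(** For a Bernoulli sequence, [g v] is the conditional probability of [C v] given the prefix [v].
    The induction fixes one more letter at a time, which is why it starts from an arbitrary prefix
    [u]. *)
Lemma probability_prefix_from (p : R) (Y : nat -> {RV P >-> bool})
    (C : seq bool -> set T) (g : seq bool -> R) n k u :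
  (forall v, measurable (C v)) ->
  (forall v, size v = (k + n)%N ->
    P ([set t | mkseq (fun i => Y i t) (k + n) = v] `&` C v) =
      (weight p v * g v)%:E) ->
  size u = k ->
  P ([set t | mkseq (fun i => Y i t) k = u] `&`
     [set t | C (mkseq (fun i => Y i t) (k + n)) t]) =
  (weight p u * bexp p n (fun z => g (u ++ z)))%:E.
Proof.
move=> mC; elim: n k u => [|n IH] k u hC uk.
  rewrite addn0 in hC *; rewrite /= cats0 -hC //; congr (P _).
  by apply/seteqP; split=> t /= [e]; rewrite e.
pose S b := [set t | mkseq (fun i => Y i t) k.+1 = rcons u b] `&`
     [set t | C (mkseq (fun i => Y i t) (k.+1 + n)) t].
have PS b : P (S b) = (weight p (rcons u b) * bexp p n (fun z => g (u ++ b :: z)))%:E.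
  rewrite /S IH ?size_rcons ?uk //; last by rewrite addSnnS.
  by congr (_ * bexp p n _)%:E; apply/funext => z; rewrite cat_rcons.
have mS b : measurable (S b).
  apply: measurableI.
    apply: (@measurable_prefix Y k.+1 (fun v => [set _ | v = rcons u b])) => v.
    exact: measurable_prop.
  exact: measurable_prefix.
rewrite (_ : _ `&` _ = S true `|` S false); last first.
  apply/seteqP; split=> t; rewrite /S /= addSnnS mkseqS.
    by move=> [-> Ct]; case: (Y k t); [left|right].
  by case=> -[/rcons_inj[-> _] Ct].
transitivity (P (S true) + P (S false))%E.
  apply: measureU => //; apply/seteqP; split=> t //=.
  by rewrite /S /= => -[[-> _] [/rcons_inj[]]].
rewrite !PS -EFinD /weight !big_rcons /=; congr EFin.
ring.
Qed.

Lemma probability_prefix (p : R) (Y : nat -> {RV P >-> bool})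
    (C : seq bool -> set T) (g : seq bool -> R) n :
  (forall v, measurable (C v)) ->
  (forall v, size v = n ->
    P ([set t | mkseq (fun i => Y i t) n = v] `&` C v) =
      (\prod_(b <- v) bern p b * g v)%:E) ->
  P [set t | C (mkseq (fun i => Y i t) n) t] = (bexp p n g)%:E.
Proof.
move=> mC hC.
have := @probability_prefix_from p Y C g n 0 [::] mC hC erefl.
rewrite /weight big_nil mul1r /= => <-; congr (P _).
by apply/seteqP; split=> t //= -[].
Qed.

Lemma probability_prefix1 (p : R) (Y : nat -> {RV P >-> bool})
    (B : seq bool -> Prop) n : bernoulli_sequence p Y ->
  P [set t | B (mkseq (fun i => Y i t) n)] =
  (bexp p n (fun y => `[< B y >]%:R))%:E.
Proof.
move=> bY; apply: (@probability_prefix p Y (fun v => [set _ | B v])) => v.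
  exact: measurable_prop.
move=> vn; case: asboolP => Bv.
  rewrite (_ : [set _ | B v] = setT); last by apply/seteqP; split.
  by rewrite setIT mulr1 (probability_cylinder bY vn).
rewrite (_ : [set _ | B v] = set0); last by apply/seteqP; split.
by rewrite setI0 measure0 mulr0.
Qed.

(** Fubini for finite prefixes: by independence, fixing the prefix [x] of [X] leaves the probability
    of [B x] for [Y]. *)
Lemma probability_prefix2 (pX pY : R) (X Y : nat -> {RV P >-> bool})
    (B : seq bool -> seq bool -> Prop) n m :
  bernoulli_sequence pX X -> bernoulli_sequence pY Y -> independent_seqs X Y ->
  P [set t | B (mkseq (fun i => X i t) n) (mkseq (fun j => Y j t) m)] =
  (bexp pX n (fun x => bexp pY m (fun y => `[< B x y >]%:R)))%:E.
Proof.
move=> bX bY indXY.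
pose C x := [set t | B x (mkseq (fun j => Y j t) m)].
apply: (@probability_prefix pX X C) => x.
  apply: (@measurable_prefix Y m (fun y => [set _ | B x y])) => y.
  exact: measurable_prop.
move=> xn; rewrite indXY.
- by rewrite (probability_cylinder bX xn) (probability_prefix1 (B x) m bY).
- exact: (@sigma_of_seq_prefix X n (fun u => u = x)).
- exact: (@sigma_of_seq_prefix Y m (B x)).
Qed.

End prefixes.

(** * From finite prefixes to infinite words *)

Section seen_probability.
Context d (T : measurableType d) (R : realType) (P : probability T R).

Section continuity.
Context (M : nat) (w y : T -> nat -> bool).
Hypothesis mseen : forall n, measurable [set t | seen_upto M n (w t) (y t)].

Let seen_bigcap :
  [set t | seen_in M (w t) (y t)] = \bigcap_n [set t | seen_upto M n (w t) (y t)].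
Proof.
apply/seteqP; split=> t /= => [/seen_inP h n _|h]; first exact: h.
by apply/seen_inP => n; exact: h.
Qed.

Lemma probability_seen_in_le n :
  (P [set t | seen_in M (w t) (y t)] <= P [set t | seen_upto M n (w t) (y t)])%E.
Proof.
rewrite seen_bigcap; apply: le_measure; rewrite ?inE //.
  exact: bigcapT_measurable.
by move=> t; apply.
Qed.

(** Continuity from above: by [seen_inP] the event is a decreasing intersection of prefix events. *)
Lemma probability_seen_in_ge (c : \bar R) :
  (forall n, c <= P [set t | seen_upto M n (w t) (y t)])%E ->
  (c <= P [set t | seen_in M (w t) (y t)])%E.
Proof.
move=> cP; rewrite seen_bigcap.
pose F n := [set t | seen_upto M n (w t) (y t)].
suff cvgF : (P \o F) n @[n --> \oo] --> P (\bigcap_n F n).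
  by apply: (cvge_ge _ cvgF); apply: nearW.
apply: nonincreasing_cvg_mu => //.
- by rewrite (le_lt_trans (probability_le1 P (mseen 0%N))) ?ltry.
- exact: bigcapT_measurable.
- by move=> i j ij; apply/subsetPset => t; exact: seen_uptoW.
Qed.

End continuity.

Let seen_upto_prefix (X Y : nat -> {RV P >-> bool}) (M n k N : nat) :
  (n <= k)%N -> (M * n <= N)%N ->
  [set t | seen_upto M n (fun i => X i t) (fun j => Y j t)] =
  [set t | seen_upto M n (nth false (mkseq (fun i => X i t) k))
                         (nth false (mkseq (fun j => Y j t) N))].
Proof.
move=> nk MN; apply/seteqP; split=> t /=; apply: eq_seen_upto => i iM;
  by rewrite nth_mkseq //; apply: leq_trans iM _.
Qed.

Let seen_upto_word_prefix (W : nat -> bool) (Y : nat -> {RV P >-> bool}) (M n N : nat) :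
  (M * n <= N)%N ->
  [set t | seen_upto M n W (fun j => Y j t)] =
  [set t | seen_upto M n W (nth false (mkseq (fun j => Y j t) N))].
Proof.
move=> MN; apply/seteqP; split=> t /=; apply: eq_seen_upto => // i iM;
  by rewrite nth_mkseq //; apply: leq_trans iM _.
Qed.

Lemma measurable_seen_upto (X Y : nat -> {RV P >-> bool}) (M n : nat) :
  measurable [set t | seen_upto M n (fun i => X i t) (fun j => Y j t)].
Proof.
rewrite (seen_upto_prefix _ _ (leqnn n) (leqnn (M * n))).
pose C x := [set t | seen_upto M n (nth false x)
                       (nth false (mkseq (fun j => Y j t) (M * n)))].
apply: (measurable_prefix X n (C := C)) => x.
apply: (measurable_prefix Y (M * n)
  (C := fun y => [set _ | seen_upto M n (nth false x) (nth false y)])) => y.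
exact: measurable_prop.
Qed.

Lemma measurable_seen_upto_word (W : nat -> bool) (Y : nat -> {RV P >-> bool}) (M n : nat) :
  measurable [set t | seen_upto M n W (fun j => Y j t)].
Proof.
rewrite (seen_upto_word_prefix _ _ (leqnn (M * n))).
apply: (measurable_prefix Y (M * n)
  (C := fun y => [set _ | seen_upto M n W (nth false y)])) => y.
exact: measurable_prop.
Qed.

(** Since [k] and [N] only have to be large enough, the lengths can be matched to those of the block
    comparison. *)
Lemma probability_seen_upto (pX pY : R) (X Y : nat -> {RV P >-> bool}) (M n k N : nat) :
  bernoulli_sequence pX X -> bernoulli_sequence pY Y -> independent_seqs X Y ->
  (n <= k)%N -> (M * n <= N)%N ->
  P [set t | seen_upto M n (fun i => X i t) (fun j => Y j t)] =
  (bexp pX k (fun x => bexp pY N (fun y =>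
     `[< seen_upto M n (nth false x) (nth false y) >]%:R)))%:E.
Proof.
move=> bX bY XY nk MN; rewrite (seen_upto_prefix _ _ nk MN).
exact: (probability_prefix2 (fun x y => seen_upto M n (nth false x) (nth false y))).
Qed.

Lemma probability_seen_upto_word (p : R) (W : nat -> bool)
    (Y : nat -> {RV P >-> bool}) (M n N : nat) :
  bernoulli_sequence p Y -> (M * n <= N)%N ->
  P [set t | seen_upto M n W (fun j => Y j t)] =
  (bexp p N (fun y => `[< seen_upto M n W (nth false y) >]%:R))%:E.
Proof.
move=> bY MN; rewrite (seen_upto_word_prefix _ _ MN).
exact: (probability_prefix1 (fun y => seen_upto M n W (nth false y))).
Qed.

End seen_probability.

Lemma ler_asbool (R : numDomainType) (A B : Prop) :
  (A -> B) -> `[< A >]%:R <= `[< B >]%:R :> R.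
Proof. by move=> AB; rewrite ler_nat; case: asboolP => // /AB /asboolT ->. Qed.

(** * Changing the parameters *)

Section change_of_parameter.
Context (R : realType).

Lemma bexp_seen_word (p p' : R) (L M n N : nat) (w : nat -> bool) :
  0 < p < 1 -> 0 < p' < 1 -> p ^+ L <= p' -> (1 - p) ^+ L <= 1 - p' ->
  (M * n <= N)%N ->
  bexp p' N (fun z => `[< seen_upto M n w (nth false z) >]%:R) <=
  bexp p (L * N) (fun y => `[< seen_upto (L * M.+1) n w (nth false y) >]%:R).
Proof.
move=> p01 p'01 pL qL MN; apply: le_bexp_blocks => // z y zN yN zy.
apply: ler_asbool; apply: seen_upto_blocks => k kMn.
by apply: zy; exact: leq_trans MN.
Qed.

Lemma bexp_subword (p p' : R) (L M n N : nat) (q : R) :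
  0 < p < 1 -> 0 < p' < 1 -> p ^+ L <= p' -> (1 - p) ^+ L <= 1 - p' ->
  0 < q < 1 ->
  bexp p (L * n) (fun x => bexp q N (fun y =>
    `[< seen_upto M (L * n) (nth false x) (nth false y) >]%:R)) <=
  bexp p' n (fun z => bexp q N (fun y =>
    `[< seen_upto (M * L.*2) n (nth false z) (nth false y) >]%:R)).
Proof.
(* The cut sequence is on the smaller side here, so [le_bexp_blocks] is applied to the negated
   functions. *)
move=> p01 p'01 pL qL q01; rewrite -lerN2 -!bexpN.
apply: le_bexp_blocks => // z x zn xn zx; rewrite lerN2.
by apply: le_bexp => // y _; apply: ler_asbool; exact: seen_upto_subword.
Qed.

End change_of_parameter.

Theorem theorem13 (R : realType) :
  (forall (pX pY pX' pY' : R),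
     0 < pX < 1 -> 0 < pY < 1 -> 0 < pX' < 1 -> 0 < pY' < 1 ->
   forall (d : measure_display) (T : measurableType d) (P : probability T R)
     (X Y : nat -> {RV P >-> bool})
     (d' : measure_display) (T' : measurableType d') (P' : probability T' R)
     (X' Y' : nat -> {RV P' >-> bool}),
     bernoulli_sequence pX X -> bernoulli_sequence pY Y ->
     independent_seqs X Y ->
     bernoulli_sequence pX' X' -> bernoulli_sequence pY' Y' ->
     independent_seqs X' Y' ->
     (forall M : nat, (2 <= M)%N ->
        P [set t | seen_in M (fun i => X i t) (fun j => Y j t)] = 0%E) ->
     forall M : nat, (2 <= M)%N ->
       P' [set t | seen_in M (fun i => X' i t) (fun j => Y' j t)] = 0%E)
  /\
  (forall (W : nat -> bool) (pY pY' : R),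
     0 < pY < 1 -> 0 < pY' < 1 ->
   forall (d : measure_display) (T : measurableType d) (P : probability T R)
     (Y : nat -> {RV P >-> bool})
     (d' : measure_display) (T' : measurableType d') (P' : probability T' R)
     (Y' : nat -> {RV P' >-> bool}),
     bernoulli_sequence pY Y -> bernoulli_sequence pY' Y' ->
     (forall M : nat, (2 <= M)%N ->
        P [set t | seen_in M W (fun j => Y j t)] = 0%E) ->
     forall M : nat, (2 <= M)%N ->
       P' [set t | seen_in M W (fun j => Y' j t)] = 0%E).
Proof.
split.
- move=> pX pY pX' pY' pX01 pY01 pX'01 pY'01 d T P X Y d' T' P' X' Y'
    bX bY XY bX' bY' XY' null M M2.
  (* [X'] is cut to produce letters of parameter [pX], and [Y] is cut to produce letters of
     parameter [pY']. *)
  have [L [XL qXL]] := block_length pX'01 pX01.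
  have [L' [YL qYL]] := block_length pY01 pY'01.
  have L'0 : (0 < L')%N by case: (L') YL => //; rewrite expr0 => ?; lra.
  have L0 : (0 < L)%N by case: (L) XL => //; rewrite expr0 => ?; lra.
  (* Thinning [X'] raises the gap bound from [M] to [M1]; cutting [Y] then raises it to
     [L' * M1.+1], where [null] is applied. *)
  pose M1 := (M * L.*2)%N.
  apply/eqP; rewrite eq_le measure_ge0 andbT.
  rewrite -(null (L' * M1.+1)%N); last by rewrite /M1; nia.
  apply: probability_seen_in_ge => n; first exact: measurable_seen_upto.
  apply: le_trans (probability_seen_in_le P' _ (L * n)) _ => [?|].
    exact: measurable_seen_upto.
  (* The length [M1.+1 * n] is chosen so that its blocks make up the [L' * M1.+1 * n] letters of [Y]
     that may be inspected. *)
  rewrite (probability_seen_upto (k := L * n) (N := M1.+1 * n) bX' bY' XY' (leqnn _)); last first.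
    by rewrite /M1 mulnA; nia.
  rewrite (probability_seen_upto (k := n) (N := L' * (M1.+1 * n)) bX bY XY) ?mulnA //.
  rewrite lee_fin; apply: le_trans (bexp_subword _ _ _ pX'01 pX01 XL qXL pY'01) _.
  apply: le_bexp => // x _; rewrite -mulnA; apply: bexp_seen_word => //.
  by rewrite leq_mul.
- move=> W p p' p01 p'01 d T P Y d' T' P' Y' bY bY' null M M2.
  (* The word is fixed, so cutting [Y] is the only change. *)
  have [L [pL qL]] := block_length p01 p'01.
  have L0 : (0 < L)%N by case: (L) pL => //; rewrite expr0 => ?; lra.
  apply/eqP; rewrite eq_le measure_ge0 andbT.
  rewrite -(null (L * M.+1)%N); last by nia.
  apply: probability_seen_in_ge => n; first exact: measurable_seen_upto_word.
  apply: le_trans (probability_seen_in_le P' _ n) _ => [?|].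
    exact: measurable_seen_upto_word.
  rewrite (probability_seen_upto_word (N := M.+1 * n) _ bY'); last by rewrite leq_mul.
  rewrite (probability_seen_upto_word (N := L * (M.+1 * n)) _ bY) ?mulnA //.
  by rewrite lee_fin -mulnA; apply: bexp_seen_word => //; rewrite leq_mul.
Qed.
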